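(* Let $\chi_1,\chi_2$ be fixed primitive nontrivial Dirichlet characters modulo $q_1,q_2$ respectively, with $\chi_1\chi_2(-1)=1$. For $\alpha>0$ and $C>1$ let $$F(\alpha,C)=\#\{(a,c)\in\mathbb{Z}^2 : 1\le a<c\le C,\ \gcd(a,c)=1,\ q_1q_2\mid c,\ |S_{\chi_1,\chi_2}(a,c)|>\alpha\log^3 C\}.$$ Then for $C$ large and $\alpha>1$, $$F(\alpha,C)\ll_{\chi_1,\chi_2}\frac{C^2}{\alpha}+C^2\,\frac{\log\log C}{\log C}.$$ That is, there exist constants $K,C_0>0$ depending only on $\chi_1,\chi_2$ such that $F(\alpha,C)\le K\left(\frac{C^2}{\alpha}+C^2\frac{\log\log C}{\log C}\right)$ for all $C\ge C_0$ and all $\alpha>1$.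
   Context: For integers $a,c$ with $c\ge 1$, $\gcd(a,c)=1$ and $q_1q_2\mid c$, the newform Dedekind sum is $$S_{\chi_1,\chi_2}(a,c)=\sum_{j \bmod c}\ \sum_{n \bmod q_1}\overline{\chi_2}(j)\,\overline{\chi_1}(n)\,B_1\!\left(\frac{j}{c}\right)B_1\!\left(\frac{n}{q_1}+\frac{aj}{c}\right),$$ where $B_1(x)=x-\lfloor x\rfloor-\frac12$ if $x\in\mathbb{R}\setminus\mathbb{Z}$ and $B_1(x)=0$ if $x\in\mathbb{Z}$. (It is also written $S_{\chi_1,\chi_2}(\gamma)$ for any $\gamma=\begin{pmatrix}a&b\\c&d\end{pmatrix}\in\Gamma_0(q_1q_2)$ with first column $(a,c)$.) Here $\log^3 C=(\log C)^3$. *)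

(* Defs.v *)
From HB Require Import structures.
From mathcomp Require Import all_boot all_order all_algebra.
From mathcomp Require Import finmap.
From mathcomp Require Import all_classical all_reals.
From mathcomp Require Import exp.
From mathcomp Require Import complex.

Set Implicit Arguments.
Unset Strict Implicit.
Unset Printing Implicit Defensive.

Import Order.TTheory GRing.Theory Num.Theory.
Local Open Scope classical_set_scope.
Local Open Scope ring_scope.
Local Open Scope complex_scope.

(* [chi 1 = 1] follows from multiplicativity and [chi 1 != 0]. *)
Record dirichlet_character (R : realType) (q : nat) (chi : int -> R[i]) : Prop :=
  DirichletCharacter {
    dirichlet_modulus_gt0 : (0 < q)%N ;
    dirichlet_periodic : forall n : int, chi (n + q%:Z) = chi n ;
    dirichlet_mul : {morph chi : m n / m * n} ;
    dirichlet_eq0 : forall n : int, (chi n == 0) = ~~ coprimez n q%:Z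
  }.

Definition induced_by (R : realType) (q : nat) (chi psi : int -> R[i]) : Prop :=
  forall n : int, coprimez n q%:Z -> chi n = psi n.

Definition primitive_character (R : realType) (q : nat) (chi : int -> R[i]) :
    Prop :=
  dirichlet_character q chi /\
  forall (d : nat) (psi : int -> R[i]), (d %| q)%N -> (d < q)%N ->
    dirichlet_character d psi -> ~ induced_by q chi psi.

Definition nontrivial_character (R : realType) (q : nat) (chi : int -> R[i]) :
    Prop :=
  exists2 n : int, coprimez n q%:Z & chi n != 1.

Definition B1 (R : realType) (x : R) : R :=
  if x \is a Num.int then 0 else x - (Num.floor x)%:~R - 2^-1.

(* The summand depends only on j mod c and n mod q1, so the sums over residue
   classes are taken over the representatives 0 <= j < c and 0 <= n < q1;
   for c >= 1, [`|c|%N] is c itself. *)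
Definition newform_dedekind_sum (R : realType) (q1 : nat)
    (chi1 chi2 : int -> R[i]) (a c : int) : R[i] :=
  \sum_(j < `|c|%N) \sum_(n < q1)
    (chi2 j%:Z)^* * (chi1 n%:Z)^* *
    (B1 (j%:R / c%:~R : R))%:C *
    (B1 (n%:R / q1%:R + a%:~R * j%:R / c%:~R : R))%:C.

Definition large_values (R : realType) (q1 q2 : nat)
    (chi1 chi2 : int -> R[i]) (alpha C : R) : set (int * int) :=
  [set p : int * int |
    [/\ 1 <= p.1, p.1 < p.2 & p.2%:~R <= C] /\
    [/\ coprimez p.1 p.2, ((q1 * q2)%N%:Z %| p.2)%Z &
        (alpha * ln C ^+ 3)%:C < `|newform_dedekind_sum q1 chi1 chi2 p.1 p.2|]].

Lemma finite_large_values (R : realType) (q1 q2 : nat)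
    (chi1 chi2 : int -> R[i]) (alpha C : R) :
  finite_set (large_values q1 q2 chi1 chi2 alpha C).
Proof.
pose N := (Num.truncn C).+1.
pose f (p : nat * nat) : int * int := (p.1%:Z, p.2%:Z).
apply: (@sub_finite_set _ _ (f @` (`I_N `*` `I_N))); last first.
  by apply: finite_image; apply: finite_setX; apply: finite_II.
move=> [a c] [+ _]; rewrite [(a, c).1]/= [(a, c).2]/= => -[a1 ac cC].
have a0 : 0 <= a by rewrite (le_trans _ a1).
have c0 : 0 <= c by rewrite (le_trans a0)// ltW.
case: a a1 ac a0 => [a|//] a1 ac _; case: c ac cC c0 => [c|//] ac cC _.
have cN : (c < N)%N.
  by rewrite -(ltr_nat R) (le_lt_trans cC)// truncnS_gt.
exists (a, c) => //; split => //=.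
by apply: ltn_trans cN; rewrite -ltz_nat.
Qed.

(* [fset_set] of an infinite set is empty; [finite_large_values] rules out
   that case. *)
Definition large_values_count (R : realType) (q1 q2 : nat)
    (chi1 chi2 : int -> R[i]) (alpha C : R) : nat :=
  #|` fset_set (large_values q1 q2 chi1 chi2 alpha C)|%fset.

(* Main.v *)
Require Import Defs.
From HB Require Import structures.
From mathcomp Require Import all_boot all_order all_algebra.
From mathcomp Require Import finmap cyclic.
From mathcomp Require Import all_classical all_reals.
From mathcomp Require Import sequences exp trigo.
From mathcomp Require Import complex.
From mathcomp Require Import zify ring lra.

Set Implicit Arguments.
Unset Strict Implicit.
Unset Printing Implicit Defensive.

Import Order.TTheory GRing.Theory Num.Theory.
Local Open Scope ring_scope.
Local Open Scope complex_scope.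

(** The bound is a first moment estimate.  Averaged over the residues [a] prime
to [c], the newform Dedekind sum has size only [O(log^2 c)], so that Markov's
inequality at height [alpha * log^3 C] leaves at most
[O(C^2 / (alpha * log C))] pairs, which is below the claimed bound.

The average is computed with the discrete Fourier transform on [Z/c].  Write
[w(k)] for the inverse of the chord [|1 - zeta^k|], where [zeta] is the
standard primitive [c]-th root of unity ([chordV]).  Expanding the sawtooth
[B1] that carries the [a]-dependence gives
<<
  S(a,c) = sum_h beta(h) * (sum_n conj(chi1 n) zeta^(h n c/q1)) * V(a h),
>>
where [V] is the transform of [j |-> conj(chi2 j) * B1(j/c)].  Both [beta] and
[V] are transforms of functions of bounded variation along a step of the cyclic
group (step [1] for [beta], step [q2] for [V], a shift under which [chi2] is
invariant), and summation by parts ([norm_sum_character_le]) turns a variation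
bound into decay: [beta(h)] is [O(w(h) / c)] and [V(k)] is [O(w(q2 k))],
with the trivial bound [c] when [zeta^(q2 k) = 1].

As [|1 - zeta^k|] is at least the distance from [k/c] to the integers
([chord_lower_bound]), the sum of [w] over a period is [O(c log c)]; the same
holds for the sum over [a] of [w(a k)], for any fixed [k]
([sum_chordV_mul]).  Summing over [a] and then over [h] gives
[O(c log^2 c)] for the sum of [|S(a,c)|]
([sum_norm_twisted_dedekind_sum_le]); the exceptional [h] with [c | q2 h]
are essentially the residues modulo [q2] and contribute [O(c)]. *)

(** * Chords of the unit circle *)

(** Dyadic induction towards [0]: the angle doubling formula gives
[sin (2 t) <= 2 * sin t], so a linear lower bound valid on [[1/4, 1/2]]
propagates to each smaller dyadic interval. *)
Lemma sin_pi_ge_dyadic (R : realType) (i : nat) (x : R) :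
  2^-1 <= x *+ 2 ^ i.+1 -> x <= 2^-1 -> x <= sin (pi * x).
Proof.
elim: i x => [|i IHi] x.
  rewrite expn1 => x4 x2.
  have pi0 := pi_gt0 R.
  (* On [1/4, 1/2] the cosine of the double angle is nonpositive, so that the
     square of the sine is at least 1/2. *)
  have sq : sin (pi * x) ^+ 2 = (1 - cos (pi * x *+ 2)) / 2.
    by rewrite cos_mulr2n sin2cos2; lra.
  have : cos (pi * x *+ 2) <= 0.
    have -> : pi * x *+ 2 = (pi * x *+ 2 - pi / 2) + pi / 2 by lra.
    rewrite cosDpihalf oppr_le0; apply: sin_ge0_pi; nra.
  have : 0 <= sin (pi * x) by apply: sin_ge0_pi; nra.
  nra.
move=> xi x2; have [x4|x4] := leP (x *+ 2) 2^-1; last first.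
  apply: (IHi x) => //; rewrite (le_trans (ltW x4))//.
  by rewrite ler_wpMn2l//; [lra|rewrite expnS leq_pmulr ?expn_gt0].
have pi0 := pi_gt0 R.
have x0 : 0 <= x.
  rewrite leNgt; apply/negP => x0.
  have : x *+ 2 ^ i.+2 < 0 by rewrite pmulrn_llt0 ?expn_gt0.
  lra.
have := IHi (x *+ 2); rewrite -mulrnA -expnS => /(_ xi x4).
have -> : pi * (x *+ 2) = (pi * x) *+ 2 by lra.
rewrite sin_mulr2n => H.
have s0 : 0 <= sin (pi * x) by apply: sin_ge0_pi; nra.
have c1 := cos_le1 (pi * x).
nra.
Qed.

Lemma sin_pi_ge (R : realType) (x : R) :
  0 <= x <= 2^-1 -> x <= sin (pi * x).
Proof.
move=> /andP[x0 x2]; have [->|xn0] := eqVneq x 0; first by rewrite mulr0 sin0.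
have {x0 xn0}x0 : 0 < x by rewrite lt0r xn0.
apply: (@sin_pi_ge_dyadic R (Num.truncn x^-1)) => //.
have : x^-1 < (2 ^ (Num.truncn x^-1).+1)%:R.
  by rewrite (lt_le_trans (truncnS_gt _))// ler_nat ltnW// ltn_expl.
rewrite -(ltr_pM2l x0) mulfV ?gt_eqF// mulr_natr; lra.
Qed.

Section RootsOfUnity.
Variable R : realType.
Implicit Types (n k d : nat).

Definition zeta n : R[i] := cos (pi * (2 / n%:R)) +i* sin (pi * (2 / n%:R)).

Lemma zetaX n k :
  zeta n ^+ k = cos (pi * (2 * k%:R / n%:R)) +i* sin (pi * (2 * k%:R / n%:R)).
Proof.
elim: k => [|k IHk].
  by rewrite expr0 mulr0 mul0r mulr0 cos0 sin0.
rewrite exprS IHk /zeta.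
have -> : pi * (2 * k.+1%:R / n%:R) = pi * (2 / n%:R) + pi * (2 * k%:R / n%:R) :> R.
  by rewrite -natr1; ring.
rewrite cosD sinD; apply/eqP; rewrite eq_complex /= eqxx /=.
by rewrite addrC [X in _ == X]addrC; apply/eqP; ring.
Qed.

Lemma zetaXn n : (0 < n)%N -> zeta n ^+ n = 1.
Proof.
move=> n0; rewrite zetaX mulfK ?pnatr_eq0 -?lt0n//.
by rewrite mulr_natr cos2pi sin2pi.
Qed.

Lemma zeta_modn n k : (0 < n)%N -> zeta n ^+ (k %% n) = zeta n ^+ k.
Proof.
move=> n0; rewrite [in RHS](divn_eq k n) exprD mulnC exprM zetaXn// expr1n.
by rewrite mul1r.
Qed.

(** [zeta_(d n)^d = zeta_n], also in the degenerate case [n = 0]. *)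
Lemma zeta_scale n d k : (0 < d)%N -> zeta (d * n) ^+ (d * k) = zeta n ^+ k.
Proof.
move=> d0; rewrite !zetaX.
have d1 : d%:R != 0 :> R by rewrite pnatr_eq0 -lt0n.
have -> // : 2 * (d * k)%:R / (d * n)%:R = 2 * k%:R / n%:R :> R.
rewrite !natrM invfM; move: n%:R^-1 (divff d1) => y dd.
by transitivity (d%:R / d%:R * (2 * k%:R * y)); [ring | rewrite dd mul1r].
Qed.

Lemma norm_zetaX n k : `|zeta n ^+ k| = 1.
Proof. by rewrite zetaX normc_def /= cos2Dsin2 sqrtr1. Qed.

Lemma zeta_neq0 n : zeta n != 0.
Proof. by rewrite -normr_eq0 -[zeta n]expr1 norm_zetaX oner_eq0. Qed.

(** Half-angle formula for the length of a chord. *)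
Lemma chordE n k :
  `|1 - zeta n ^+ k| = (2 * `|sin (pi * (k%:R / n%:R))|)%:C.
Proof.
rewrite zetaX normc_def /=; congr (_ +i* _).
have -> : pi * (2 * k%:R / n%:R) = pi * (k%:R / n%:R) *+ 2 :> R by lra.
set t := pi * _.
rewrite cos_mulr2n sin_mulr2n sub0r.
have -> : (1 - (cos t ^+ 2 *+ 2 - 1)) ^+ 2 + (- (cos t * sin t *+ 2)) ^+ 2
   = (2 * sin t) ^+ 2.
  have := sin2cos2 t; set s := sin t; set u := cos t => su.
  have -> : (- (u * s *+ 2)) ^+ 2 = 4 * u ^+ 2 * s ^+ 2 by ring.
  have -> : (2 * s) ^+ 2 = 4 * s ^+ 2 by ring.
  by rewrite su; ring.
by rewrite sqrtr_sqr normrM ger0_norm.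
Qed.

(** Inverse chords.  As [0^-1 = 0], this vanishes when [n] divides [k], so sums
of inverse chords need no side condition excluding these [k]. *)
Definition chordV n k : R[i] := `|1 - zeta n ^+ k|^-1.

Lemma chordV_ge0 n k : 0 <= chordV n k.
Proof. by rewrite invr_ge0. Qed.

Lemma chordV_modn n k : (0 < n)%N -> chordV n (k %% n) = chordV n k.
Proof. by move=> n0; rewrite /chordV zeta_modn. Qed.

Lemma chordV0 n : chordV n 0 = 0.
Proof. by rewrite /chordV expr0 subrr normr0 invr0. Qed.

Lemma chordV_scale n d k : (0 < d)%N -> chordV (d * n) (d * k) = chordV n k.
Proof. by move=> d0; rewrite /chordV zeta_scale. Qed.

(** The chord is at least as long as the distance from [k / n] to the nearest
integer, by [sin_pi_ge] and the symmetry of the sine about [pi / 2]; [m / n] is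
that distance. *)
Lemma chord_lower_bound n k : (0 < k < n)%N ->
  exists2 m : nat, m = k \/ m = (n - k)%N &
    (m%:R / n%:R : R)%:C <= `|1 - zeta n ^+ k|.
Proof.
move=> /andP[k0 kn]; rewrite chordE.
have n0 : (0 < n%:R :> R) by rewrite ltr0n (leq_trans _ kn).
have sge (m : nat) : (m <= n - m)%N ->
    m%:R / n%:R <= 2 * `|sin (pi * (m%:R / n%:R))| :> R.
  move=> mn; have mm : (m.*2 <= n)%N by rewrite -addnn; lia.
  have x0 : 0 <= m%:R / n%:R :> R by rewrite divr_ge0 ?ler0n.
  have x2 : m%:R / n%:R <= 2^-1 :> R.
    rewrite ler_pdivrMr// mulrC ler_pdivlMr//.
    by rewrite -natrM ler_nat muln2.
  have := @sin_pi_ge R (m%:R / n%:R); rewrite x0 x2 => /(_ isT) H.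
  by have := ler_norm (sin (pi * (m%:R / n%:R)) : R); lra.
have [kk|kk] := leqP k (n - k).
  by exists k; [left|rewrite lecR; apply: sge].
exists (n - k)%N; [by right|rewrite lecR].
have -> : sin (pi * (k%:R / n%:R)) = sin (pi * ((n - k)%:R / n%:R)) :> R.
  have -> : pi * ((n - k)%:R / n%:R) = - (pi * (k%:R / n%:R)) + pi :> R.
    by rewrite natrB 1?ltnW//; field; rewrite gt_eqF.
  by rewrite sinDpi sinN opprK.
by apply: sge; lia.
Qed.

(** Primitivity of [zeta n] comes for free from the positivity of the lower
bound on chords. *)
Lemma zeta_eq1 n k : (0 < n)%N -> (zeta n ^+ k == 1) = (n %| k)%N.
Proof.
move=> n0; rewrite -zeta_modn// /dvdn; have [->|k0] := eqVneq (k %% n)%N 0%N.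
  by rewrite expr0 eqxx.
have [|m mE] := @chord_lower_bound n (k %% n).
  by rewrite lt0n k0 ltn_mod.
move=> lem; apply/negbTE/eqP => z1; move: lem; rewrite z1 subrr normr0.
rewrite (_ : 0 = (0:R)%:C)// lecR leNgt divr_gt0 ?ltr0n//.
case: mE => ->; first by rewrite lt0n.
by rewrite subn_gt0 ltn_mod.
Qed.

(** The sum stops at [n - 1]: these are the nonzero residues modulo [n]. *)
Definition harmonic_sum n : R[i] := \sum_(1 <= k < n) k%:R^-1.

Lemma harmonic_sum_ge0 n : 0 <= harmonic_sum n.
Proof. by apply: sumr_ge0 => k _; rewrite invr_ge0. Qed.

Lemma le_harmonic_sum m n : (m <= n)%N -> harmonic_sum m <= harmonic_sum n.
Proof.
move=> mn; case: m mn => [|m] mn.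
  by rewrite {1}/harmonic_sum big_geq// harmonic_sum_ge0.
rewrite /harmonic_sum [leRHS](big_cat_nat (n := m.+1))//= lerDl.
by apply: sumr_ge0 => k _; rewrite invr_ge0.
Qed.

(** Bounding the inverse of a minimum by the sum of the inverses makes the
bound symmetric and free of case distinctions. *)
Lemma chordV_le n k : (0 < k < n)%N ->
  chordV n k <= n%:R * (k%:R^-1 + (n - k)%:R^-1).
Proof.
move=> kn; have [m mE lem] := chord_lower_bound kn.
have /andP[k0 kn'] := kn.
have m0 : (0 < m)%N by case: mE => ->; rewrite ?subn_gt0.
have n0 : (0 < n)%N by apply: leq_trans kn'.
have lem' : m%:R / n%:R <= `|1 - zeta n ^+ k|.
  apply: le_trans lem.
  by rewrite rmorphM/= fmorphV !rmorph_nat.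
have mn : 0 < m%:R / n%:R :> R[i] by rewrite divr_gt0 ?ltr0n.
rewrite /chordV (le_trans (y := (m%:R / n%:R)^-1))//.
  by rewrite lef_pV2 ?posrE// (lt_le_trans mn).
rewrite invf_div ler_pM2l ?ltr0n//.
by case: mE => ->; rewrite ?lerDl ?lerDr invr_ge0.
Qed.

Lemma sum_chordV n : \sum_(k < n) chordV n k <= 2 * n%:R * harmonic_sum n.
Proof.
case: n => [|n]; first by rewrite big_ord0 mulr0 mul0r.
rewrite big_ord_recl chordV0 add0r.
have -> : 2 * n.+1%:R * harmonic_sum n.+1 =
    \sum_(k < n) n.+1%:R * (k.+1%:R^-1 + (n - k)%:R^-1).
  rewrite -mulr_sumr big_split/=.
  have E1 : \sum_(i < n) i.+1%:R^-1 = harmonic_sum n.+1.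
    by rewrite /harmonic_sum big_add1 /= big_mkord.
  have -> : \sum_(i < n) (n - i)%:R^-1 = harmonic_sum n.+1.
    rewrite -E1 (reindex_inj rev_ord_inj)/=; apply: eq_bigr => i _.
    by rewrite subKn.
  by rewrite E1; ring.
apply: ler_sum => k _; have := @chordV_le n.+1 (bump 0 k).
rewrite /bump /= add1n ltnS ltn_ord => /(_ isT).
by rewrite subSS.
Qed.

End RootsOfUnity.

(** * Sums over a period *)

Section PeriodicSums.
Variable V : zmodType.
Implicit Types (f : nat -> V) (n : nat).

Lemma periodic_addMn f n : (forall j, f (j + n)%N = f j) ->
  forall j d, f (j + d * n)%N = f j.
Proof.
by move=> fn j; elim=> [|d IHd]; rewrite ?mul0n ?addn0// mulSnr addnA fn.
Qed.

Lemma periodic_modn f n : (forall j, f (j + n)%N = f j) ->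
  forall j, f (j %% n)%N = f j.
Proof.
by move=> fn j; rewrite [in RHS](divn_eq j n) addnC periodic_addMn.
Qed.

Lemma sum_periodic_shift f n s : (forall j, f (j + n)%N = f j) ->
  \sum_(j < n) f (j + s)%N = \sum_(j < n) f j.
Proof.
move=> fn; case: n fn => [|n] fn; first by rewrite !big_ord0.
elim: s => [|s IHs]; first by under eq_bigr do rewrite addn0.
rewrite -IHs big_ord_recr big_ord_recl /= addrC; congr (_ + _).
  by rewrite -(fn (0 + s)%N); congr f; lia.
by apply: eq_bigr => j _; rewrite /bump /=; congr f; lia.
Qed.

Lemma sum_periodic_mul f n d : (forall j, f (j + n)%N = f j) ->
  \sum_(j < d * n) f j = (\sum_(j < n) f j) *+ d.
Proof.
move=> fn; elim: d => [|d IHd]; first by rewrite mul0n big_ord0 mulr0n.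
rewrite mulSnr big_split_ord /= IHd mulrSr; congr (_ + _).
by apply: eq_bigr => j _; rewrite addnC periodic_addMn.
Qed.

Lemma sum_periodic_coprime f n b : (forall j, f (j + n)%N = f j) ->
  coprime b n -> \sum_(j < n) f (j * b)%N = \sum_(j < n) f j.
Proof.
move=> fn cbn; case: n fn cbn => [|n] fn cbn; first by rewrite !big_ord0.
have ltm (j : 'I_n.+1) : (j * b %% n.+1 < n.+1)%N by rewrite ltn_mod.
have hinj : injective (fun j : 'I_n.+1 => Ordinal (ltm j)).
  move=> i j /(congr1 val) /= ij; apply: val_inj => /=; move: ij.
  wlog le_ji : i j / (j <= i)%N.
    by move=> W; case/orP: (leq_total i j) => /W // + /esym => H /H ->.
  move/eqP; rewrite eqn_mod_dvd ?leq_mul2r ?le_ji ?orbT//.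
  rewrite -mulnBl Gauss_dvdl 1?coprime_sym// -eqn_mod_dvd// => /eqP.
  by rewrite !modn_small.
rewrite [RHS](reindex_inj hinj) /=.
by apply: eq_bigr => j _; rewrite periodic_modn.
Qed.

Lemma sum_multiples f n q : (0 < n)%N ->
  \sum_(j < q * n | (n %| j)%N) f j = \sum_(t < q) f (t * n)%N.
Proof.
move=> n0; elim: q => [|q IHq]; first by rewrite mul0n !big_ord0.
rewrite big_mkcond mulSnr big_split_ord /= -big_mkcond/= IHq big_ord_recr /=.
congr (_ + _); case: n n0 {IHq} => // n _.
rewrite big_ord_recl /= addn0 dvdn_mull// big1 ?addr0// => j _.
rewrite dvdn_addr ?dvdn_mull//; case: ifP => // /dvdn_leq => /(_ isT).
by have := ltn_ord j; rewrite /bump /=; lia.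
Qed.

End PeriodicSums.

(** Summation by parts on a cyclic group.  Multiplying the sum by [z^s] shifts
its index by [s], so [1 - z^s] times the sum is again a character sum, of the
differences [f (j + s) - f j]. *)
Lemma norm_sum_character_le (K : numDomainType) (f : nat -> K) (z : K) n s :
  (forall j, f (j + n)%N = f j) -> z ^+ n = 1 -> `|z| = 1 ->
  `|1 - z ^+ s| * `|\sum_(j < n) f j * z ^+ j| <=
    \sum_(j < n) `|f (j + s)%N - f j|.
Proof.
move=> fn zn z1; rewrite -normrM.
have -> : (1 - z ^+ s) * (\sum_(j < n) f j * z ^+ j) =
    \sum_(j < n) (f (j + s)%N - f j) * z ^+ (j + s).
  rewrite mulrBl mul1r.
  have gn j : f (j + n)%N * z ^+ (j + n) = f j * z ^+ j.
    by rewrite fn exprD zn mulr1.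
  rewrite -[X in X - _](@sum_periodic_shift _ (fun j => f j * z ^+ j) n s gn)/=.
  rewrite mulr_sumr -sumrB; apply: eq_bigr => j _.
  by rewrite exprD; ring.
apply: le_trans (ler_norm_sum _ _ _) _; apply: ler_sum => j _.
by rewrite normrM normrX z1 expr1n mulr1.
Qed.

(** * Finite Fourier analysis *)

Section FiniteFourier.
Variable R : realType.
Implicit Types (n j k h : nat).
Local Notation chordV := (@chordV R).
Local Notation zeta := (@zeta R).
Local Notation harmonic_sum := (@harmonic_sum R).

(** If [d] is the gcd of [k] and [n], the multiples [a k] run [d] times through
the multiples of [d] modulo [n], that is, through the residues modulo [n / d];
the total [d * (n / d) * log (n / d)] is largest when [d = 1]. *)
Lemma sum_chordV_mul n k : (0 < n)%N ->
  \sum_(a < n) chordV n (a * k) <= 2 * n%:R * harmonic_sum n.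
Proof.
move=> n0; set d := gcdn k n.
have d0 : (0 < d)%N by rewrite gcdn_gt0 n0 orbT.
have [/dvdnP[k1 kE] /dvdnP[n1 nE]] := (dvdn_gcdl k n, dvdn_gcdr k n).
rewrite -/d in kE nE.
have cop : coprime k1 n1.
  by rewrite /coprime -(eqn_pmul2r d0) muln_gcdl -kE -nE mul1n.
have n10 : (0 < n1)%N by move: n0; rewrite nE muln_gt0 => /andP[].
have per j : chordV n1 (j + n1) = chordV n1 j.
  by rewrite -chordV_modn// modnDr chordV_modn.
have -> : \sum_(a < n) chordV n (a * k) = (\sum_(a < n1) chordV n1 a) *+ d.
  rewrite -(sum_periodic_coprime per cop).
  rewrite -(@sum_periodic_mul _ (fun a => chordV n1 (a * k1)) n1); last first.
    by move=> j; rewrite mulnDl (mulnC n1) periodic_addMn.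
  rewrite [in LHS]nE mulnC; apply: eq_bigr => a _.
  by rewrite kE mulnA (mulnC _ d) chordV_scale.
rewrite (le_trans (y := (2 * n1%:R * harmonic_sum n1) *+ d))//.
  by rewrite lerMn2r sum_chordV orbT.
rewrite -[X in X <= _]mulr_natr nE natrM.
rewrite -!mulrA ler_pM2l ?ltr0n// ler_pM2l ?ltr0n//.
rewrite mulrC ler_pM2l ?ltr0n//.
by apply: le_harmonic_sum; rewrite leq_pmulr.
Qed.

(** The multiples of [n] modulo [q n] are a copy of the residues modulo [q]. *)
Lemma sum_chordV_multiples q n : (0 < n)%N ->
  \sum_(h < q * n | (n %| h)%N) chordV (q * n) h <= 2 * q%:R * harmonic_sum q.
Proof.
move=> n0; rewrite (sum_multiples (chordV (q * n)))//.
under eq_bigr do rewrite mulnC [(_ * n)%N]mulnC chordV_scale//.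
exact: sum_chordV.
Qed.

Lemma zeta_orthogonality n b j : (0 < n)%N ->
  \sum_(h < n) zeta n ^+ (h * b) * zeta n ^- (h * j) =
    if b == j %[mod n] then n%:R else 0.
Proof.
move=> n0; set z := zeta n ^+ b * zeta n ^- j.
have zE h : zeta n ^+ (h * b) * zeta n ^- (h * j) = z ^+ h.
  by rewrite /z exprMn exprVn -!exprM mulnC (mulnC h j).
under eq_bigr do rewrite zE.
have -> : (b == j %[mod n]) = (z == 1).
  have zj0 : zeta n ^+ j != 0 by rewrite expf_neq0// zeta_neq0.
  rewrite -(inj_eq (mulIf zj0)) /z mulfVK// mul1r.
  have [bj|jb] := leqP b j.
    rewrite -{2}(subnK bj) exprD -[X in _ = (X == _)]mul1r.
    rewrite (inj_eq (mulIf _)) ?expf_neq0 ?zeta_neq0// [RHS]eq_sym.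
    by rewrite zeta_eq1// eq_sym eqn_mod_dvd.
  have {}jb := ltnW jb.
  rewrite -{2}(subnK jb) exprD -[X in _ = (_ == X)]mul1r.
  rewrite (inj_eq (mulIf _)) ?expf_neq0 ?zeta_neq0//.
  by rewrite zeta_eq1// eqn_mod_dvd.
case: eqP => [->|/eqP z1].
  by under eq_bigr do rewrite expr1n; rewrite sumr_const card_ord.
have zn : z ^+ n = 1.
  by rewrite /z exprMn exprVn -!exprM !(mulnC _ n) !exprM zetaXn// !expr1n invr1 mulr1.
by apply: (mulfI (_ : z - 1 != 0)); rewrite ?subr_eq0// -subrX1 zn subrr mulr0.
Qed.

Definition fourier_coef n (f : nat -> R[i]) h : R[i] :=
  n%:R^-1 * \sum_(j < n) f j * zeta n ^- (h * j).

Lemma fourier_inversion n f b : (0 < n)%N -> (forall j, f (j + n)%N = f j) ->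
  f b = \sum_(h < n) fourier_coef n f h * zeta n ^+ (h * b).
Proof.
move=> n0 fn.
transitivity (n%:R^-1 * \sum_(j < n) f j *
    \sum_(h < n) zeta n ^+ (h * b) * zeta n ^- (h * j)).
  under eq_bigr do rewrite zeta_orthogonality//.
  rewrite (bigD1 (Ordinal (ltn_pmod b n0)))//= modn_mod eqxx.
  rewrite periodic_modn// big1 ?addr0; last first.
    move=> j; rewrite -val_eqE /= eq_sym => /negbTE jb.
    by rewrite (modn_small (ltn_ord j)) jb mulr0.
  by rewrite mulrC mulfK// pnatr_eq0 -lt0n.
under [RHS]eq_bigr do rewrite -mulrA mulr_suml mulr_sumr.
rewrite mulr_sumr; under [LHS]eq_bigr => j _ do rewrite mulr_sumr mulr_sumr.
rewrite exchange_big /=; apply: eq_bigr => h _; apply: eq_bigr => j _.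
by rewrite [in RHS]mulrAC -!mulrA; do 2 congr (_ * _); rewrite mulrC.
Qed.

(** The mean value hypothesis covers the frequencies [h] divisible by [n], at
which the inverse chord vanishes. *)
Lemma norm_fourier_coef_le n f h : (0 < n)%N ->
  (forall j, f (j + n)%N = f j) -> \sum_(j < n) f j = 0 ->
  `|fourier_coef n f h| <=
    n%:R^-1 * chordV n h * \sum_(j < n) `|f j.+1 - f j|.
Proof.
move=> n0 fn f0; rewrite normrM normfV normr_nat -mulrA ler_pM2l ?invr_gt0 ?ltr0n//.
under eq_bigr do rewrite exprM -exprVn.
have Vn : 0 <= \sum_(j < n) `|f j.+1 - f j| by apply: sumr_ge0.
have [nh|nh] := boolP (n %| h)%N.
  have -> : zeta n ^+ h = 1 by apply/eqP; rewrite zeta_eq1.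
  under eq_bigr do rewrite invr1 expr1n mulr1.
  by rewrite f0 normr0 mulr_ge0// chordV_ge0.
have z1 : zeta n ^+ h != 1 by rewrite zeta_eq1.
set z := (zeta n ^+ h)^-1.
have nz : `|z| = 1 by rewrite normfV norm_zetaX invr1.
have zn : z ^+ n = 1.
  by rewrite exprVn -exprM mulnC exprM zetaXn// expr1n invr1.
have := norm_sum_character_le 1 fn zn nz; rewrite expr1.
have -> : `|1 - z| = `|1 - zeta n ^+ h|.
  rewrite -[LHS]mulr1 -[X in _ * X = _](norm_zetaX R n h) -normrM mulrBl mul1r mulVf.
    by rewrite distrC.
  by rewrite expf_neq0// zeta_neq0.
rewrite mulrC -ler_pdivlMr ?normr_gt0 ?subr_eq0 1?eq_sym//.
by rewrite [chordV _ _ * _]mulrC; under [X in X / _]eq_bigr do rewrite addn1.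
Qed.

End FiniteFourier.

(** * The sawtooth function *)

Section Sawtooth.
Variable R : realType.
Implicit Types (x : R) (n j : nat).

Lemma B1D1 x : B1 (x + 1) = B1 x.
Proof.
rewrite /B1 rpredDr ?rpred1//; case: ifP => // _.
by rewrite floorDrz ?rpred1// floor1 rmorphD/=; ring.
Qed.

Lemma norm_B1_le x : `|B1 x| <= 2^-1.
Proof.
rewrite /B1; case: ifP => _; first by rewrite normr0 invr_ge0.
have := floor_le x; have := floorD1_gt x; rewrite rmorphD/= => h1 h2.
by rewrite ler_norml; apply/andP; split; lra.
Qed.

Lemma B1_itv01 x : 0 < x < 1 -> B1 x = x - 2^-1.
Proof.
move=> /andP[x0 x1]; rewrite /B1; case: ifPn => [/intrP[m mE]|_].
  move: x0 x1; rewrite mE ltr0z -[1]/(1%:~R) ltr_int; lia.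
have -> : Num.floor x = 0 by apply: floor_def; rewrite add0r x1 ltW.
by rewrite subr0.
Qed.

Lemma B1_frac n j : (0 < j < n)%N -> B1 (j%:R / n%:R : R) = j%:R / n%:R - 2^-1.
Proof.
move=> /andP[j0 jn]; have n0 : (0 < n)%N by apply: leq_trans jn.
by rewrite B1_itv01// divr_gt0 ?ltr0n//= ltr_pdivrMr ?ltr0n// mul1r ltr_nat.
Qed.

Lemma B1_frac_periodic n j :
  (0 < n)%N -> B1 ((j + n)%:R / n%:R : R) = B1 (j%:R / n%:R : R).
Proof.
move=> n0; rewrite natrD mulrDl divff ?B1D1// pnatr_eq0 -lt0n//.
Qed.

(** Odd symmetry [j |-> n - j] of the sawtooth. *)
Lemma sum_B1_frac n : \sum_(j < n) B1 (j%:R / n%:R : R) = 0.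
Proof.
case: n => [|n]; first by rewrite big_ord0.
have -> : \sum_(j < n.+1) B1 (j%:R / n.+1%:R : R) =
    \sum_(j < n) B1 (j.+1%:R / n.+1%:R : R).
  by rewrite big_ord_recl mul0r /B1 rpred0 add0r.
set S := \sum_(j < n) _; suff : S = - S by lra.
rewrite {1}/S (reindex_inj rev_ord_inj)/= -sumrN; apply: eq_bigr => j _.
have jn := ltn_ord j; rewrite !B1_frac; [|lia..].
have -> : (n - j.+1).+1 = (n.+1 - j.+1)%N by lia.
have : n.+1%:R != 0 :> R by rewrite pnatr_eq0.
by rewrite natrB 1?ltnW//; move: (n.+1%:R : R) => x x0; field.
Qed.

(** The sawtooth rises by [1 / n] at each step, except at the two steps next to
its discontinuity. *)
Lemma sum_B1_frac_variation n : (0 < n)%N ->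
  \sum_(j < n) `|B1 (j.+1%:R / n%:R) - B1 (j%:R / n%:R) : R| <= 3.
Proof.
case: n => // n _.
(* A majorant of the increments: the two Kronecker symbols account for the
   steps into and out of the value 0 at the integer. *)
pose g (j : 'I_n.+1) : R := n.+1%:R^-1 + (j == ord0)%:R + (j == ord_max)%:R.
have n0 : 0 < n.+1%:R :> R by rewrite ltr0n.
have Vn : 0 < n.+1%:R^-1 :> R by rewrite invr_gt0.
apply: (@le_trans _ _ (\sum_j g j)).
  apply: ler_sum => j _; rewrite /g.
  have triv : `|B1 (j.+1%:R / n.+1%:R) - B1 (j%:R / n.+1%:R) : R| <= 1.
    apply: le_trans (ler_normB _ _) _.
    have -> : 1 = 2^-1 + 2^-1 :> R by lra.
    exact: lerD (norm_B1_le _) (norm_B1_le _).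
  have [_|j0] := eqVneq j ord0.
    rewrite (le_trans triv)// -addrA addrCA [true%:R]/(1 : R) lerDl.
    by rewrite addr_ge0// ltW.
  have [_|jm] := eqVneq j ord_max.
    by rewrite (le_trans triv)// addr0 [true%:R]/(1 : R) lerDr ltW.
  have jn : (0 < j < n)%N.
    by move: j0 jm (ltn_ord j); rewrite -!val_eqE /=; lia.
  rewrite !B1_frac; [|lia..].
  rewrite (_ : _ - _ = n.+1%:R^-1); last by rewrite -[j.+1%:R]natr1; ring.
  by rewrite gtr0_norm// !addr0.
rewrite !big_split/= sumr_const card_ord -[_ *+ n.+1]mulr_natr mulVf ?gt_eqF//.
rewrite (bigD1 ord0)//= big1 => [|j /negbTE ->//].
rewrite (bigD1 ord_max)//= eqxx big1 => [|j /negbTE ->//].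
by rewrite /= !mulr1n !addr0; lra.
Qed.

End Sawtooth.

Lemma sum_shift_variation_le (K : numDomainType) (f : nat -> K) n s :
  (forall j, f (j + n)%N = f j) ->
  \sum_(j < n) `|f (j + s)%N - f j| <= s%:R * \sum_(j < n) `|f j.+1 - f j|.
Proof.
move=> fn; elim: s => [|s IHs].
  by rewrite mul0r big1// => j _; rewrite addn0 subrr normr0.
rewrite -natr1 mulrDl mul1r.
rewrite -[X in _ <= _ + X](@sum_periodic_shift _ (fun j => `|f j.+1 - f j|) n s); last first.
  by move=> j; rewrite -addSn !fn.
apply: le_trans (lerD IHs (lexx _)); rewrite -big_split/=; apply: ler_sum => j _.
by rewrite addnS [leRHS]addrC -[_ - f j](subrKA (f (j + s)%N)) ler_normD.
Qed.

(** * Twisted Dedekind sums *)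

Section TwistedSums.
Variable R : realType.
Implicit Types (n j k h a q : nat).
Local Notation chordV := (@chordV R).
Local Notation zeta := (@zeta R).
Local Notation harmonic_sum := (@harmonic_sum R).

Definition sawtooth n j : R[i] := (B1 (j%:R / n%:R : R))%:C.

Lemma sawtooth_periodic n j : (0 < n)%N -> sawtooth n (j + n) = sawtooth n j.
Proof. by move=> n0; rewrite /sawtooth B1_frac_periodic. Qed.

Lemma normC_real (x : R) : `|x%:C| = `|x|%:C.
Proof. by rewrite normc_def /= expr0n addr0 sqrtr_sqr. Qed.

Lemma norm_sawtooth_le1 n j : `|sawtooth n j| <= 1.
Proof.
rewrite normC_real (_ : 1 = (1 : R)%:C)// lecR (le_trans (norm_B1_le _))//.
by rewrite invf_le1// ler1n.
Qed.

Lemma sum_sawtooth n : \sum_(j < n) sawtooth n j = 0.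
Proof. by rewrite -rmorph_sum/= sum_B1_frac. Qed.

Lemma sum_sawtooth_variation n : (0 < n)%N ->
  \sum_(j < n) `|sawtooth n j.+1 - sawtooth n j| <= 3.
Proof.
move=> n0; under eq_bigr do rewrite -rmorphB normC_real.
rewrite -rmorph_sum/= (_ : 3 = (3 : R)%:C) ?lecR ?sum_B1_frac_variation//.
by rewrite rmorph_nat.
Qed.

(** The discrete Fourier transform, at frequency [- k], of a periodic weight
times the sawtooth. *)
Definition twisted_sum (psi : nat -> R[i]) n k : R[i] :=
  \sum_(j < n) psi j * sawtooth n j * (zeta n ^+ k) ^+ j.

Lemma norm_twisted_sum_le_modulus psi n k : (forall j, `|psi j| <= 1) ->
  `|twisted_sum psi n k| <= n%:R.
Proof.
move=> psi1; apply: le_trans (ler_norm_sum _ _ _) _.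
rewrite -[n in leRHS]card_ord -sumr_const; apply: ler_sum => j _.
rewrite !normrM normrX norm_zetaX expr1n mulr1.
by rewrite mulr_ile1// norm_sawtooth_le1.
Qed.

(** A shift by the period [q] of the weight [psi] sees only the variation of
the sawtooth, whence the step [q] in the summation by parts. *)
Lemma norm_twisted_sum_le psi q n k : (0 < n)%N -> (q %| n)%N ->
    (forall j, psi (j + q)%N = psi j) -> (forall j, `|psi j| <= 1) ->
    ~~ (n %| k * q)%N ->
  `|twisted_sum psi n k| <= 3 * q%:R * chordV n (k * q).
Proof.
move=> n0 /dvdnP[d nE] psiq psi1 nkq.
pose f j := psi j * sawtooth n j.
have fn j : f (j + n)%N = f j.
  by rewrite /f sawtooth_periodic// nE periodic_addMn.
have zn : (zeta n ^+ k) ^+ n = 1 by rewrite -exprM mulnC exprM zetaXn// expr1n.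
have := norm_sum_character_le q fn zn (norm_zetaX _ _ _).
rewrite -exprM mulrC -ler_pdivlMr ?normr_gt0 ?subr_eq0 1?eq_sym ?zeta_eq1//.
move=> /le_trans; apply; rewrite ler_wpM2r ?chordV_ge0//.
apply: (@le_trans _ _ (\sum_(j < n) `|sawtooth n (j + q) - sawtooth n j|)).
  apply: ler_sum => j _; rewrite /f psiq -mulrBr normrM ler_piMl//.
apply: le_trans (sum_shift_variation_le _ _) _.
  by move=> j; rewrite sawtooth_periodic.
by rewrite mulrC ler_wpM2r// sum_sawtooth_variation.
Qed.

(** The newform Dedekind sum of modulus [c = q * m], with the conjugate
characters replaced by arbitrary weights and the two arguments of the sawtooth
written over the common denominator [c]. *)
Definition twisted_dedekind_sum (psi1 psi2 : nat -> R[i]) q m a : R[i] :=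
  \sum_(j < q * m) \sum_(n < q)
    psi2 j * psi1 n * sawtooth (q * m) j * sawtooth (q * m) (n * m + a * j).

Lemma twisted_dedekind_sum_fourier psi1 psi2 q m a (c := (q * m)%N) :
    (0 < c)%N ->
  twisted_dedekind_sum psi1 psi2 q m a =
    \sum_(h < c) fourier_coef c (sawtooth c) h *
      (\sum_(n < q) psi1 n * zeta c ^+ (h * (n * m))) * twisted_sum psi2 c (a * h).
Proof.
move=> c0; rewrite /twisted_dedekind_sum -/c.
transitivity (\sum_(j < c) \sum_(n < q) \sum_(h < c)
   psi2 j * psi1 n * sawtooth c j *
   (fourier_coef c (sawtooth c) h * zeta c ^+ (h * (n * m + a * j)))).
  apply: eq_bigr => j _; apply: eq_bigr => n _; rewrite -mulr_sumr.
  by rewrite -fourier_inversion// => i; rewrite sawtooth_periodic.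
under eq_bigr do rewrite exchange_big/=.
rewrite exchange_big/=; apply: eq_bigr => h _.
rewrite /twisted_sum mulr_sumr; apply: eq_bigr => j _.
rewrite mulr_sumr mulr_suml; apply: eq_bigr => n _.
by rewrite mulnDr exprD -exprM (_ : a * h * j = h * (a * j))%N; [ring|lia].
Qed.

Lemma norm_twisted_dedekind_sum_le psi1 psi2 q m a
    (c := (q * m)%N) : (0 < c)%N -> (forall j, `|psi1 j| <= 1) ->
  `|twisted_dedekind_sum psi1 psi2 q m a| <=
    3 * q%:R / c%:R * \sum_(h < c) chordV c h * `|twisted_sum psi2 c (a * h)|.
Proof.
move=> c0 psi1_le; rewrite twisted_dedekind_sum_fourier// -/c.
apply: le_trans (ler_norm_sum _ _ _) _; rewrite mulr_sumr.
apply: ler_sum => h _; rewrite 2!normrM mulrA ler_wpM2r//.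
have b0 : `|fourier_coef c (sawtooth c) h| <= 3 / c%:R * chordV c h.
  apply: le_trans (norm_fourier_coef_le _ _ _ _) _ => //.
  - by move=> j; rewrite sawtooth_periodic.
  - exact: sum_sawtooth.
  rewrite -[leRHS]mulrA [leRHS]mulrC ler_wpM2l ?sum_sawtooth_variation//.
  by rewrite mulr_ge0 ?invr_ge0 ?chordV_ge0.
have g0 : `|\sum_(n < q) psi1 n * zeta c ^+ (h * (n * m))| <= q%:R.
  apply: le_trans (ler_norm_sum _ _ _) _.
  rewrite -[q in leRHS]card_ord -sumr_const; apply: ler_sum => j _.
  by rewrite normrM norm_zetaX mulr1.
apply: le_trans (ler_pM _ _ b0 g0) _ => //.
by rewrite le_eqVlt; apply/orP; left; apply/eqP; ring.
Qed.

(** For [a] prime to [n], the frequency [a h q] is divisible by [n] only if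
[h q] is; so the trivial bound [n] is used for all [a] or for none. *)
Lemma sum_coprime_norm_twisted_sum psi q n h : (0 < n)%N -> (q %| n)%N ->
    (forall j, psi (j + q)%N = psi j) -> (forall j, `|psi j| <= 1) ->
  \sum_(a < n | coprime a n) `|twisted_sum psi n (a * h)| <=
    6 * q%:R * n%:R * harmonic_sum n + (n %| h * q)%:R * n%:R ^+ 2.
Proof.
move=> n0 qn psiq psi1; have [nhq|nhq] := boolP (n %| h * q)%N.
  rewrite mul1r (le_trans (y := n%:R ^+ 2))//; last first.
    by rewrite lerDr !mulr_ge0// harmonic_sum_ge0.
  apply: (@le_trans _ _ (\sum_(a < n) (n%:R : R[i]))); last first.
    by rewrite sumr_const card_ord -[_ *+ n]mulr_natr.
  rewrite big_mkcond; apply: ler_sum => a _; case: ifP => _ //.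
  exact: norm_twisted_sum_le_modulus.
rewrite mul0r addr0.
apply: (@le_trans _ _ (\sum_(a < n) 3 * q%:R * chordV n (a * (h * q)))).
  rewrite big_mkcond; apply: ler_sum => a _; case: ifPn => [cop|_]; last first.
    by rewrite !mulr_ge0// chordV_ge0.
  rewrite mulnA; apply: norm_twisted_sum_le => //.
  by rewrite -mulnA Gauss_dvdr// coprime_sym.
rewrite -mulr_sumr.
apply: le_trans (ler_wpM2l _ (sum_chordV_mul R (h * q) n0)) _.
  by rewrite mulr_ge0.
by rewrite le_eqVlt; apply/orP; left; apply/eqP; ring.
Qed.

(** The second term collects the frequencies [h] with [c | h q2], for which the
inner sum has no decay; there are few of them and they are far from [0]
modulo [c], so that they cost no logarithm of [c]. *)
Lemma sum_norm_twisted_dedekind_sum_le psi1 psi2 q1 q2 m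
    (c := (q1 * m)%N) : (0 < c)%N -> (q2 %| c)%N ->
    (forall j, `|psi1 j| <= 1) ->
    (forall j, psi2 (j + q2)%N = psi2 j) -> (forall j, `|psi2 j| <= 1) ->
  \sum_(a < c | coprime a c) `|twisted_dedekind_sum psi1 psi2 q1 m a| <=
    36 * q1%:R * q2%:R * c%:R * harmonic_sum c ^+ 2 +
    6 * q1%:R * q2%:R * harmonic_sum q2 * c%:R.
Proof.
move=> c0 q2c psi1_le psi2q psi2_le.
have cN0 : c%:R != 0 :> R[i] by rewrite pnatr_eq0 -lt0n.
have q20 : (0 < q2)%N.
  by case: q2 q2c {psi2q} => //; rewrite dvd0n => /eqP c00; rewrite c00 in c0.
apply: (@le_trans _ _ (\sum_(a < c | coprime a c) 3 * q1%:R / c%:R *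
    \sum_(h < c) chordV c h * `|twisted_sum psi2 c (a * h)|)).
  by apply: ler_sum => a _; apply: norm_twisted_dedekind_sum_le.
rewrite -mulr_sumr exchange_big/=.
apply: (@le_trans _ _ (3 * q1%:R / c%:R * \sum_(h < c) chordV c h *
    (6 * q2%:R * c%:R * harmonic_sum c + (c %| h * q2)%:R * c%:R ^+ 2))).
  rewrite ler_wpM2l ?mulr_ge0 ?invr_ge0 ?ler0n//.
  apply: ler_sum => h _; rewrite -mulr_sumr ler_wpM2l ?chordV_ge0//.
  exact: sum_coprime_norm_twisted_sum.
under eq_bigr do rewrite mulrDr.
rewrite big_split/= -mulr_suml.
have -> : \sum_(h < c) chordV c h * ((c %| h * q2)%:R * c%:R ^+ 2) =
   (\sum_(h < c | (c %| h * q2)%N) chordV c h) * c%:R ^+ 2.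
  rewrite mulr_suml [RHS]big_mkcond; apply: eq_bigr => h _.
  by case: ifP => _; rewrite ?mul1r// mul0r mulr0.
have [n nE] := dvdnP q2c.
have n0 : (0 < n)%N by move: c0; rewrite nE muln_gt0 => /andP[].
have m1 : \sum_(h < c | (c %| h * q2)%N) chordV c h <= 2 * q2%:R * harmonic_sum q2.
  have := sum_chordV_multiples R q2 n0; rewrite [(q2 * n)%N]mulnC -nE.
  by under eq_bigl do rewrite -(dvdn_pmul2r q20) -nE.
have m2 := sum_chordV R c.
apply: (@le_trans _ _ (3 * q1%:R / c%:R * (2 * c%:R * harmonic_sum c *
   (6 * q2%:R * c%:R * harmonic_sum c) + 2 * q2%:R * harmonic_sum q2 * c%:R ^+ 2))).
  rewrite ler_wpM2l ?mulr_ge0 ?invr_ge0 ?ler0n//.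
  apply: lerD; rewrite ler_wpM2r// ?exprn_ge0//.
  by rewrite !mulr_ge0// harmonic_sum_ge0.
by rewrite le_eqVlt; apply/orP; left; apply/eqP; field.
Qed.

End TwistedSums.

(** * Dirichlet characters *)

Section Characters.
Variables (R : realType) (q : nat) (chi : int -> R[i]).
Hypothesis chiP : dirichlet_character q chi.

Lemma dirichlet1 : chi 1 = 1.
Proof.
have c1 : chi 1 != 0 by rewrite (dirichlet_eq0 chiP) negbK /coprimez gcd1z.
by apply: (mulfI c1); rewrite -(dirichlet_mul chiP) !mulr1.
Qed.

Lemma dirichletX (n k : nat) : chi (n ^ k)%N%:Z = chi n%:Z ^+ k.
Proof.
elim: k => [|k IHk]; first by rewrite expn0 expr0 dirichlet1.
by rewrite expnS exprS -IHk -(dirichlet_mul chiP) PoszM.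
Qed.

Lemma dirichlet_periodic_nat (j : nat) : chi (j + q)%N%:Z = chi j%:Z.
Proof. by rewrite PoszD (dirichlet_periodic chiP). Qed.

(** The nonzero values are roots of unity, by Euler's theorem. *)
Lemma norm_dirichlet_le1 (n : nat) : `|chi n%:Z| <= 1.
Proof.
have [cop|ncop] := boolP (coprime n q); last first.
  suff -> : chi n%:Z = 0 by rewrite normr0.
  by apply/eqP; rewrite (dirichlet_eq0 chiP) coprimezE.
have chiq := periodic_modn dirichlet_periodic_nat.
have : chi n%:Z ^+ totient q = 1.
  by rewrite -dirichletX -chiq (Euler_exp_totient cop) chiq dirichlet1.
move=> /(congr1 Num.norm); rewrite normrX normr1 => /eqP.
by rewrite pexpr_eq1 ?totient_gt0 ?(dirichlet_modulus_gt0 chiP)// => /eqP ->.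
Qed.

End Characters.

(** * The mean value of the newform Dedekind sum *)

Section MeanValue.
Variable R : realType.

Lemma newform_dedekind_sumE (q m a : nat) (chi1 chi2 : int -> R[i]) :
  (0 < q)%N -> (0 < m)%N ->
  newform_dedekind_sum q chi1 chi2 a%:Z (q * m)%N%:Z =
  twisted_dedekind_sum (fun n => (chi1 n%:Z)^*) (fun j => (chi2 j%:Z)^*) q m a.
Proof.
move=> q0 m0; apply: eq_bigr => j _; apply: eq_bigr => n _.
congr (_ * _ * (B1 _)%:C).
have q1 : q%:R != 0 :> R by rewrite pnatr_eq0 -lt0n.
have m1 : m%:R != 0 :> R by rewrite pnatr_eq0 -lt0n.
rewrite -!pmulrn natrD !natrM; field.
by rewrite m1.
Qed.

(** Each step uses [1 / (n + 1) <= - ln (1 - 1 / (n + 1))]. *)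
Lemma harmonic_sum_le_ln (n : nat) : (0 < n)%N ->
  harmonic_sum R n.+1 <= (1 + ln n%:R)%:C.
Proof.
elim: n => // -[|n] IHn _.
  by rewrite /harmonic_sum big_nat1 invr1 ln1 addr0.
rewrite /harmonic_sum big_nat_recr//= (le_trans (lerD (IHn isT) (lexx _)))//.
have -> : n.+2%:R^-1 = (n.+2%:R^-1)%:C :> R[i] by rewrite fmorphV rmorph_nat.
rewrite -rmorphD lecR -addrA lerD2l.
have n2 : n.+2%:R != 0 :> R by rewrite pnatr_eq0.
have n2p : 0 < n.+2%:R :> R by rewrite ltr0n.
have := @le_ln1Dx R (- n.+2%:R^-1).
have -> : 1 + - n.+2%:R^-1 = n.+1%:R / n.+2%:R :> R.
  have -> : n.+1%:R = n.+2%:R - 1 :> R by rewrite -[n.+2%:R]natr1 addrK.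
  by rewrite mulrBl divff// mul1r.
rewrite ln_div ?posrE ?ltr0n// ltrN2 invf_lt1// ltr1n => /(_ isT).
by move: n.+2%:R^-1 (ln n.+1%:R) (ln n.+2%:R) => x y z; lra.
Qed.

Lemma harmonic_sum_le (n : nat) : harmonic_sum R n <= n%:R.
Proof.
rewrite /harmonic_sum; case: n => [|n]; first by rewrite big_geq.
rewrite big_add1 /= (@le_trans _ _ (\sum_(0 <= i < n) 1))//.
  by apply: ler_sum => i _; rewrite invf_le1 ?ler1n ?ltr0n.
by rewrite sumr_const_nat subn0 ler_nat.
Qed.

(** [150 = 36 * 2 ^ 2 + 6], from the two terms of
[sum_norm_twisted_dedekind_sum_le] when the harmonic sum is at most [2 * l] and
the one of modulus [q2] is bounded by [q2].  The factor [2] lets [l] stand for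
[ln C] alone, absorbing the [1] in [1 + ln C]. *)
Lemma sum_coprime_norm_newform_le (q1 q2 c : nat) (chi1 chi2 : int -> R[i]) (l : R) :
  dirichlet_character q1 chi1 -> dirichlet_character q2 chi2 ->
  (0 < c)%N -> (q1 * q2 %| c)%N -> 1 <= l -> harmonic_sum R c <= (2 * l)%:C ->
  \sum_(a < c | coprime a c) `|newform_dedekind_sum q1 chi1 chi2 a%:Z c%:Z| <=
    (150 * q1 * q2 ^ 2)%N%:R * c%:R * (l ^+ 2)%:C.
Proof.
move=> chi1P chi2P c0 q12c l1 Hl.
have q10 := dirichlet_modulus_gt0 chi1P.
have q20 := dirichlet_modulus_gt0 chi2P.
have [m cE] : exists m, c = (q1 * m)%N.
  have /dvdnP[m ->] := dvdn_trans (dvdn_mulr q2 (dvdnn q1)) q12c.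
  by exists m; rewrite mulnC.
have m0 : (0 < m)%N by move: c0; rewrite cE muln_gt0 => /andP[].
have newformE a := @newform_dedekind_sumE q1 m a chi1 chi2 q10 m0.
rewrite -cE in newformE; under eq_bigr do rewrite newformE.
have := @sum_norm_twisted_dedekind_sum_le R (fun n => (chi1 n%:Z)^*)
  (fun j => (chi2 j%:Z)^*) q1 q2 m; rewrite -cE => /(_ c0).
move=> /(_ (dvdn_trans (dvdn_mull q1 (dvdnn q2)) q12c)) H.
apply: le_trans (H _ _ _) _.
- by move=> j; rewrite normcJ (norm_dirichlet_le1 chi1P).
- by move=> j; rewrite (dirichlet_periodic_nat chi2P).
- by move=> j; rewrite normcJ (norm_dirichlet_le1 chi2P).
have H2 : harmonic_sum R c ^+ 2 <= 4 * (l ^+ 2)%:C.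
  rewrite (le_trans (lerXn2r 2 _ _ Hl)) ?nnegrE ?harmonic_sum_ge0//.
    by rewrite ler0c; lra.
  have -> : 4 = (4 : R)%:C :> R[i] by rewrite rmorph_nat.
  by rewrite -rmorphXn -rmorphM lecR; nra.
have l2 : 1 <= (l ^+ 2)%:C by rewrite (_ : 1 = (1:R)%:C)// lecR; nra.
set L := (l ^+ 2)%:C in H2 l2 *.
apply: (@le_trans _ _ (36 * q1%:R * q2%:R * c%:R * (4 * L) +
    6 * q1%:R * q2%:R * q2%:R * c%:R * L)).
  apply: lerD; first by rewrite ler_wpM2l// !mulr_ge0.
  rewrite -[leLHS]mulr1; apply: ler_pM => //.
    by rewrite !mulr_ge0// harmonic_sum_ge0.
  by rewrite ler_wpM2r// ler_wpM2l ?harmonic_sum_le// !mulr_ge0.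
have L0 : 0 <= L by apply: le_trans l2.
rewrite !natrM.
have -> : 36 * q1%:R * q2%:R * c%:R * (4 * L) = q1%:R * c%:R * L * (144 * q2%:R) by ring.
have -> : 6 * q1%:R * q2%:R * q2%:R * c%:R * L = q1%:R * c%:R * L * (6 * q2%:R ^+ 2) by ring.
have -> : 150 * q1%:R * (q2%:R * q2%:R) * c%:R * L =
   q1%:R * c%:R * L * (150 * q2%:R ^+ 2) by ring.
rewrite -mulrDr ler_wpM2l ?mulr_ge0//.
by rewrite -natrX -!natrM -natrD ler_nat; nia.
Qed.

End MeanValue.

(** * Counting large values *)

Lemma sum_subset_le (K : numDomainType) (I : eqType) (s t : seq I) (F : I -> K) :
  uniq s -> uniq t -> {subset s <= t} -> (forall i, 0 <= F i) ->
  \sum_(i <- s) F i <= \sum_(i <- t) F i.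
Proof.
move=> us ut st F0; rewrite [leRHS](bigID [in s])/=.
rewrite -[X in _ <= X + _]big_filter [X in _ <= X + _](perm_big s).
  by rewrite lerDl sumr_ge0.
apply: uniq_perm; rewrite ?filter_uniq// => i.
by rewrite mem_filter andb_idr//; apply: st.
Qed.

(** Markov's inequality for the counting measure on pairs. *)
Lemma card_mul_le_sum (K : numDomainType) (A : {fset int * int}) (N : nat)
    (t : K) (P : nat -> nat -> bool) (F : nat -> nat -> K) :
  (forall p, p \in A -> exists a c : nat,
     [/\ p = (a%:Z, c%:Z), (a < c)%N, (c <= N)%N, P a c & t <= F a c]) ->
  (forall a c, 0 <= F a c) ->
  #|` A|%:R * t <= \sum_(c < N.+1) \sum_(a < c | P a c) F a c.
Proof.
move=> AP F0.
pose pairs := [seq (a%:Z, c%:Z) | c <- iota 0 N.+1, a <- iota 0 c].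
pose G (p : int * int) := if P `|p.1|%N `|p.2|%N then F `|p.1|%N `|p.2|%N else 0.
have iotaE n : iota 0 n = index_iota 0 n by rewrite /index_iota subn0.
have -> : \sum_(c < N.+1) \sum_(a < c | P a c) F a c = \sum_(p <- pairs) G p.
  rewrite /pairs big_allpairs_dep iotaE big_mkord; apply: eq_bigr => c _.
  by rewrite iotaE big_mkord big_mkcond.
apply: (@le_trans _ _ (\sum_(p <- A) G p)).
  rewrite card_fset_sum1 natr_sum mulr_suml big_seq [leRHS]big_seq.
  by apply: ler_sum => p /AP[a [c [-> _ _ Pac tF]]]; rewrite mul1r /G /= Pac.
apply: sum_subset_le; first exact: fset_uniq.
- apply: allpairs_uniq_dep => //; first exact: iota_uniq.
  + by move=> c _; apply: iota_uniq.
  + by move=> [c a] [c' a'] _ _ /= [-> ->].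
- move=> p /AP[a [c [-> ac cN _ _]]]; apply/allpairsPdep.
  by exists c, a; split; rewrite ?mem_iota ?add0n.
- by move=> p; rewrite /G; case: ifP.
Qed.

Theorem theorem1p3 (R : realType) (q1 q2 : nat) (chi1 chi2 : int -> R[i])
    (prim1 : primitive_character q1 chi1)
    (prim2 : primitive_character q2 chi2)
    (nontriv1 : nontrivial_character q1 chi1)
    (nontriv2 : nontrivial_character q2 chi2)
    (even12 : chi1 (-1) * chi2 (-1) = 1) :
  exists K C0 : R, [/\ 0 < K, 0 < C0 &
    forall C alpha : R, C0 <= C -> 1 < alpha ->
      (large_values_count q1 q2 chi1 chi2 alpha C)%:R <=
        K * (C ^+ 2 / alpha + C ^+ 2 * (ln (ln C) / ln C))].
Proof.
have [chi1P _] := prim1; have [chi2P _] := prim2.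
have q10 := dirichlet_modulus_gt0 chi1P.
have q20 := dirichlet_modulus_gt0 chi2P.
pose M := (150 * q1 * q2 ^ 2)%N.
have M0 : (0 < M)%N by rewrite !muln_gt0 q10 q20.
exists (2 * M%:R), (expR 1); split; rewrite ?expR_gt0 ?mulr_gt0 ?ltr0n//.
move=> C alpha eC alpha1; have C0 : 0 < C := lt_le_trans (expR_gt0 _) eC.
have l1 : 1 <= ln C by rewrite -[leLHS]expRK ler_ln ?posrE ?expR_gt0.
have C1 : 1 <= C by rewrite (le_trans _ eC)// -[leLHS]expR0 ler_expR.
set l := ln C in l1 *; pose N := Num.truncn C.
have NC : N%:R <= C by rewrite truncn_le ltW.
have N0 : (0 < N)%N by rewrite truncn_gt0.
pose t : R[i] := (alpha * l ^+ 3)%:C.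
have HN : harmonic_sum R N.+1 <= (2 * l)%:C.
  apply: le_trans (harmonic_sum_le_ln R N0) _; rewrite lecR.
  have : ln N%:R <= l by rewrite ler_ln ?posrE ?ltr0n.
  lra.
(* The term c = 0 is kept out by the last factor, so that the sum has N
   nonzero terms, each at most of order N * ln(C)^2. *)
have count : (large_values_count q1 q2 chi1 chi2 alpha C)%:R * t <=
    \sum_(c < N.+1) M%:R * N%:R * (l ^+ 2)%:C * (0 < c)%:R.
  apply: le_trans (card_mul_le_sum (N := N)
    (P := fun a c => [&& (0 < c)%N, (q1 * q2 %| c)%N & coprime a c])
    (F := fun a c => `|newform_dedekind_sum q1 chi1 chi2 a%:Z c%:Z|) _ _) _ => //.
    move=> p; rewrite in_fset_set; last exact: finite_large_values.
    rewrite inE => -[[]]; case: p => -[a|//] [c|//] /= a1 ac cC [cop dvd /ltW S].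
    exists a, c; split=> //.
    - by rewrite truncn_ge_nat// ltW.
    - by rewrite coprimezE in cop; rewrite [coprime a c]cop andbT (leq_ltn_trans _ ac).
  apply: ler_sum => c _; have [c0|c0] := posnP c.
    by rewrite big_pred0_eq mulr0.
  rewrite mulr1; have [dvd|ndvd] := boolP (q1 * q2 %| c)%N; last first.
    by rewrite big_pred0_eq !mulr_ge0// ler0c sqr_ge0.
  apply: le_trans (sum_coprime_norm_newform_le chi1P chi2P c0 dvd l1 _) _.
    by rewrite (le_trans _ HN)// le_harmonic_sum// ltnW.
  rewrite ler_wpM2r ?ler0c ?sqr_ge0// ler_wpM2l// ler_nat.
  by rewrite -ltnS.
have {}count : (large_values_count q1 q2 chi1 chi2 alpha C)%:R * (alpha * l ^+ 3) <=
    M%:R * N%:R ^+ 2 * l ^+ 2.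
  rewrite -lecR rmorphM/= rmorph_nat (le_trans count)//.
  rewrite -mulr_sumr big_ord_recl mulr0n add0r/= sumr_const card_ord.
  by rewrite !rmorphM/= !rmorph_nat le_eqVlt; apply/orP; left; apply/eqP; ring.
have lnl : 0 <= C ^+ 2 * (ln l / l).
  by rewrite mulr_ge0 ?sqr_ge0// divr_ge0 ?ln_ge0//; lra.
have alpha0 : 0 < alpha by lra.
(* Here ln(C)^3 beats ln(C)^2, and the second term of the claimed bound is
   merely nonnegative, as 1 <= ln C. *)
set F : R := _%:R in count *.
have F0 : 0 <= F by [].
have Falpha : F * alpha <= M%:R * C ^+ 2.
  have l2 : 0 < l ^+ 2 by rewrite exprn_gt0//; lra.
  rewrite -(ler_pM2r l2) (le_trans (y := M%:R * N%:R ^+ 2 * l ^+ 2))//; last first.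
    rewrite ler_wpM2r ?(ltW l2)// ler_wpM2l// lerXn2r ?nnegrE//.
    exact: ltW.
  apply: le_trans count; rewrite -mulrA ler_wpM2l// ler_pM2l//.
  by rewrite [leRHS]exprS ler_peMl// ltW.
have {}Falpha : F <= M%:R * (C ^+ 2 / alpha) by rewrite mulrA ler_pdivlMr.
have MX : 0 <= M%:R * (C ^+ 2 * (ln l / l)) by rewrite mulr_ge0.
lra.
Qed.
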